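(* There is no pair $(X_0,R_0)$, with $X_0$ a Polish space and $R_0\subseteq X_0^2$ an analytic graph, such that for every Polish space $X$ and every analytic graph $A\subseteq X^2$ exactly one of the following holds: (a) there is a Borel map $c:X\to\omega$ such that $(x,y)\in A$ implies $c(x)\neq c(y)$; (b) there is a continuous one-to-one map $u:X_0\to X$ with $R_0\subseteq (u\times u)^{-1}(A)$.
   Context: A graph on a set $X$ is an irreflexive and symmetric relation $A\subseteq X^2$. *)

(* Defs.v *)
From HB Require Import structures.
From mathcomp Require Import all_boot all_order all_algebra.
From mathcomp Require Import all_classical all_reals all_analysis.

Set Implicit Arguments.
Unset Strict Implicit.
Unset Printing Implicit Defensive.

Import Order.TTheory GRing.Theory Num.Theory.

Local Open Scope classical_set_scope.
Local Open Scope ring_scope.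

Definition is_metric (R : realType) (T : Type) (d : T -> T -> R) : Prop :=
  [/\ forall x y, 0 <= d x y,
      forall x y, d x y = 0 <-> x = y,
      forall x y, d x y = d y x &
      forall x y z, d x z <= d x y + d y z].

Definition metrizes (R : realType) (T : topologicalType) (d : T -> T -> R)
    : Prop :=
  is_metric d /\
  forall (x : T) (V : set T),
    nbhs x V <-> exists2 e : R, 0 < e & [set y | d x y < e] `<=` V.

Definition cauchy_sequence (R : realType) (T : Type) (d : T -> T -> R)
    (u : nat -> T) : Prop :=
  forall e : R, 0 < e ->
    exists N : nat, forall m n : nat,
      (N <= m)%N -> (N <= n)%N -> d (u m) (u n) < e.

Definition completely_metrizable (R : realType) (T : topologicalType) : Prop :=
  exists d : T -> T -> R, metrizes d /\
    forall u : nat -> T, cauchy_sequence d u -> exists l : T, u @ \oo --> l.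

Definition separable_space (T : topologicalType) : Prop :=
  exists2 D : set T, countable D & dense D.

(* The notion does not depend on the realType R, which only serves as the
   codomain of the metrics. The empty space is Polish. *)
Definition polish (R : realType) (T : topologicalType) : Prop :=
  separable_space T /\ completely_metrizable R T.

(* Since Y may be empty, the empty set is analytic. *)
Definition analytic (R : realType) (T : topologicalType) (A : set T) : Prop :=
  exists Y : topologicalType, polish R Y /\
    exists2 f : Y -> T, continuous f & range f = A.

Definition borel (T : topologicalType) : set (set T) := <<s @open T >>.

Definition borel_map (S T : topologicalType) (f : S -> T) : Prop :=
  forall B : set T, borel B -> borel (f @^-1` B).

Definition is_graph (T : Type) (A : set (T * T)) : Prop :=
  (forall x, ~ A (x, x)) /\ (forall x y, A (x, y) -> A (y, x)).

Definition analytic_graph (R : realType) (T : topologicalType)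
    (A : set (T * T)) : Prop :=
  is_graph A /\ analytic R A.

(* The type nat carries the discrete topology. *)
Definition has_countable_borel_coloring (T : topologicalType)
    (A : set (T * T)) : Prop :=
  exists2 c : T -> nat, borel_map c & forall x y, A (x, y) -> c x <> c y.

Definition has_injective_continuous_hom (S T : topologicalType)
    (G : set (S * S)) (A : set (T * T)) : Prop :=
  exists u : S -> T, [/\ continuous u, injective u &
    G `<=` (fun p => (u p.1, u p.2)) @^-1` A].

Definition exactly_one (P Q : Prop) : Prop := (P \/ Q) /\ ~ (P /\ Q).

(* Main.v *)
Require Import Defs.
From HB Require Import structures.
From mathcomp Require Import all_boot all_order all_algebra.
From mathcomp Require Import all_classical all_reals all_analysis.
From mathcomp Require Import measurable_realfun.
From mathcomp Require Import ring lra zify.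

(** Suppose that (X0, R0) is as forbidden. Taking X = X0 and u = id, R0 has no
    countable Borel coloring. Hence R0 maps into every analytic graph of
    uncountable Borel chromatic number, and two of them are enough.

    The first is |x - y| = 3^-n on the real line: it is triangle-free by parity,
    and not colorable by Steinhaus' theorem, so R0 is triangle-free.

    The second is on the subsets V of a countable dense set (e_i) of reals, V
    being adjacent to its cuts f_i(V) = {e_j in V | e_j < e_i} for e_i in V. It has
    no countable coloring at all, by Kurepa's argument: a coloring yields a
    strictly increasing real function on subsets ordered by end-extension,
    whose values choose the next point of a chain that can always be prolonged.

    Let u be an injective homomorphism from R0 to the second graph, and let D_i
    be the set of the x with an R0-neighbour y such that u(y) = f_i(u(x)). If x
    and x' in D_i were adjacent, one of u(x), u(x') would be a cut of the other
    above e_i, so that f_i(u(x)) = f_i(u(x')); then x and x' would have the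
    common neighbour y: a triangle. So D_i is independent, and so is the
    complement of the union of the D_i. As D_i is analytic, it is contained in
    a Borel independent set, and R0 has a countable Borel coloring. *)

Set Implicit Arguments.
Unset Strict Implicit.
Unset Printing Implicit Defensive.

Import Order.TTheory GRing.Theory Num.Theory.
Import numFieldNormedType.Exports.
Local Open Scope classical_set_scope.
Local Open Scope ring_scope.

(** * Borel sets and Borel colorings *)

Section borel_sets.
Variable T : topologicalType.

Lemma borel_open (U : set T) : open U -> borel U.
Proof. by move=> oU; exact: sub_sigma_algebra. Qed.

Lemma borelC (B : set T) : borel B -> borel (~` B).
Proof. by move=> bB; rewrite -setTD; exact: sigma_algebraCD. Qed.

Lemma borel0 : borel (@set0 T).
Proof. exact: sigma_algebra0. Qed.

Lemma borelT : borel (@setT T).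
Proof. by rewrite -setC0; apply: borelC; exact: borel0. Qed.

Lemma borel_bigcup (F : nat -> set T) :
  (forall n, borel (F n)) -> borel (\bigcup_n F n).
Proof. exact: sigma_algebra_bigcup. Qed.

Lemma borel_bigcap (F : nat -> set T) :
  (forall n, borel (F n)) -> borel (\bigcap_n F n).
Proof.
move=> bF; rewrite -[\bigcap_n _]setCK setC_bigcap; apply: borelC.
by apply: borel_bigcup => n; apply: borelC.
Qed.

Lemma borelU (A B : set T) : borel A -> borel B -> borel (A `|` B).
Proof.
move=> bA bB; rewrite -bigcup2E; apply: borel_bigcup => -[|[|n]] //=.
exact: borel0.
Qed.

Lemma borelI (A B : set T) : borel A -> borel B -> borel (A `&` B).
Proof.
move=> bA bB; rewrite -[A `&` B]setCK setCI; apply: borelC.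
by apply: borelU; apply: borelC.
Qed.

End borel_sets.

Lemma borel_map_nat (T : topologicalType) (c : T -> nat) :
  (forall n, borel (c @^-1` [set n])) -> borel_map c.
Proof.
move=> bc B _.
have -> : c @^-1` B = \bigcup_n (if `[< B n >] then c @^-1` [set n] else set0).
  apply/seteqP; split=> [x Bx|x [n _]].
    by exists (c x) => //; rewrite asboolT.
  by case: asboolP => // Bn; rewrite /preimage /= => ->.
apply: borel_bigcup => n; case: ifP => _; [exact: bc|exact: borel0].
Qed.

(** A point gets color [m.+1] if [B m] is the first of the sets to contain it, and color [0] if none
    does. *)
Lemma borel_coloring_of_cover (T : topologicalType) (A : set (T * T))
    (B : nat -> set T) :
  (forall n, borel (B n)) ->
  (forall n x y, B n x -> B n y -> ~ A (x, y)) ->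
  (forall x y, (forall n, ~ B n x) -> (forall n, ~ B n y) -> ~ A (x, y)) ->
  has_countable_borel_coloring A.
Proof.
move=> bB indB ind0.
pose D n := if n is m.+1 then B m `\` \bigcup_k (if (k < m)%N then B k else set0)
  else ~` \bigcup_k B k.
have bD n : borel (D n).
  case: n => [|n]; first by apply: borelC; exact: borel_bigcup.
  apply: borelI => //; apply: borelC; apply: borel_bigcup => k.
  by case: ifP => // _; exact: borel0.
have Dex x : exists n, `[< D n x >].
  have [[n Bn]|nB] := pselect (exists n, B n x); last first.
    by exists 0%N; apply/asboolP => -[k _ Bk]; apply: nB; exists k.
  have ex : exists n, `[< B n x >] by exists n; apply/asboolP.
  case: (ex_minnP ex) => m /asboolP Bm min.
  exists m.+1; apply/asboolP; split=> // -[k _].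
  case: ifP => // km Bk; have := min k; rewrite asboolT// => /(_ isT).
  by rewrite leqNgt km.
have Duniq x m n : D m x -> D n x -> m = n.
  wlog mn : m n / (m < n)%N => [wl|].
    case: (ltngtP m n) => // h Dm Dn; first exact: wl.
    by apply/esym; exact: wl.
  case: m n mn => [|m] [|n] //= mn.
    by move=> h [Bn _]; exfalso; apply: h; exists n.
  by move=> [Bm _] [_ h]; exfalso; apply: h; exists m => //; rewrite -ltnS mn.
exists (fun x => xchoose (Dex x)).
  apply: borel_map_nat => n; have := bD n; congr borel.
  apply/seteqP; split=> x /=.
    by move=> Dx; apply: (Duniq x) => //; apply/asboolP; exact: (xchooseP (Dex x)).
  by move=> <-; apply/asboolP; exact: (xchooseP (Dex x)).
move=> x y Axy.
move: (xchooseP (Dex x)) (xchooseP (Dex y)) => /asboolP Dx /asboolP Dy xy.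
move: Dx Dy; rewrite xy; case: (xchoose _) => [|m] /=.
  by move=> hx hy; apply: (ind0 x y) Axy => k Bk; [apply: hx|apply: hy]; exists k.
by move=> [Bx _] [By _]; exact: (indB m x y) Axy.
Qed.

(** * Polish spaces *)

Lemma expr_half_lt (R : realType) (r : R) : 0 < r -> exists n, 2^-1 ^+ n < r.
Proof.
move=> r0.
have : (fun n => 2^-1 ^+ n : R) @ \oo --> (0 : R).
  by apply: cvg_expr; rewrite ger0_norm ?invr_ge0// invf_lt1// ltr1n.
move=> /cvgrPdist_lt /(_ _ r0)[n _ /(_ n (leqnn _))/= h]; exists n.
by move: h; rewrite sub0r normrN ger0_norm// exprn_ge0// invr_ge0.
Qed.

Section metrics.
Variables (R : realType) (T : topologicalType) (d : T -> T -> R).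
Hypothesis md : metrizes d.

Lemma metric_ball_open x r : open [set y | d x y < r].
Proof.
have [[_ _ _ dtri] nb] := md.
rewrite openE => y /= yr; apply/nb; exists (r - d x y); first by rewrite subr_gt0.
by move=> z /=; rewrite ltrBrDl; apply: le_lt_trans; exact: dtri.
Qed.

Lemma metric_ball_nbhs x r : 0 < r -> nbhs x [set y | d x y < r].
Proof. by move=> r0; apply/md.2; exists r. Qed.

Lemma metric_separation x y : x <> y ->
  exists U V : set T, [/\ open U, open V, U x, V y & U `&` V = set0].
Proof.
move=> xy; have [[d0 dE dC dtri] nb] := md.
have dxy : 0 < d x y.
  by rewrite lt_neqAle d0 andbT eq_sym; apply/eqP => /dE.
have dd z : d z z = 0 by apply/dE.
exists [set z | d x z < d x y / 2], [set z | d y z < d x y / 2]; split.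
- exact: metric_ball_open.
- exact: metric_ball_open.
- by rewrite /= dd divr_gt0.
- by rewrite /= dd divr_gt0.
apply/seteqP; split=> // z [/= xz yz].
by have := dtri x z y; rewrite [d z y]dC; move: xz yz; lra.
Qed.

Lemma separable_seq : separable_space T -> T -> exists a : nat -> T,
  forall y r, 0 < r -> exists k, d (a k) y < r.
Proof.
move=> [D cD dD] y0.
have /pcard_injP[h hinj] := cD.
(* [h] injects [D] into [nat]; [f n] is the point of [D] coded by [n], with [y0] as default. *)
have /choice[f fP] n : exists x, forall y, D y -> h y = n -> x = y.
  have [[y [Dy <-]]|no] := pselect (exists y, D y /\ h y = n).
    by exists y => z Dz hzy; apply: hinj; rewrite ?inE.
  by exists y0 => y Dy hy; exfalso; apply: no; exists y.
exists f => y r r0.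
have [[d0 dE dC dtri] nb] := md.
have [||z [/= yz Dz]] := dD [set z | d y z < r].
- by exists y => /=; have -> : d y y = 0 by apply/dE.
- exact: metric_ball_open.
by exists (h z); rewrite (fP _ z)// dC.
Qed.

Hypothesis complete_d : forall u : nat -> T,
  cauchy_sequence d u -> exists l : T, u @ \oo --> l.

(** The [S n] may fail to be closed, so [l] can lie outside them; what is kept is that they shrink
    to [l]. Points picked in them form a Cauchy sequence, the diameter of [S n] being at most
    [2 * 2^-1 ^+ n]. *)
Lemma cantor_intersection (S : nat -> set T) (a : nat -> T) :
  (forall n, S n !=set0) -> (forall n, S n.+1 `<=` S n) ->
  (forall n, S n `<=` [set y | d (a n) y < 2^-1 ^+ n]) ->
  exists l : T, forall U, nbhs l U -> exists n, S n `<=` U.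
Proof.
move=> S0 SS Sa; have [[d0 dE dC dtri] nb] := md.
have SSmn m n : (m <= n)%N -> S n `<=` S m.
  elim: n => [|n IH]; first by rewrite leqn0 => /eqP ->.
  rewrite leq_eqVlt => /predU1P[->//|]; rewrite ltnS => /IH.
  by apply: subset_trans; exact: SS.
pose u n := projT1 (cid (S0 n)).
have uS n : S n (u n) := projT2 (cid (S0 n)).
have Sdiam n x y : S n x -> S n y -> d x y < 2 * 2^-1 ^+ n.
  move=> /Sa /= Sx /Sa /= Sy; have := dtri x (a n) y; rewrite [d x (a n)]dC.
  by lra.
have [|l ul] := complete_d (u := u).
  move=> r r0; have [|N Nr] := @expr_half_lt R (r / 2); first by rewrite divr_gt0.
  exists N => m n Nm Nn.
  have := Sdiam N _ _ (SSmn _ _ Nm _ (uS m)) (SSmn _ _ Nn _ (uS n)); lra.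
exists l => U /nb[r r0 rU].
(* With [r / 4] the diameter of [S N] stays below [r / 2], which leaves [r / 2] for the distance
   from [l] to a late term of [u]. *)
have [|N Nr] := @expr_half_lt R (r / 4); first by rewrite divr_gt0.
have r2 : 0 < r / 2 by rewrite divr_gt0.
have [M _ uM] := ul _ (metric_ball_nbhs l r2).
exists N => x Sx; apply: rU => /=.
have := dtri l (u (maxn M N)) x.
have := uM (maxn M N) (leq_maxl _ _).
have := Sdiam N _ x (SSmn _ _ (leq_maxr M N) _ (uS _)) Sx.
by rewrite /=; lra.
Qed.

End metrics.

Lemma polish_real (R : realType) : polish R R.
Proof.
split.
  exists (@ratr R @` setT); last exact: dense_rat.
  exact: card_le_trans (card_image_le _ _) (countableP _).
exists (fun x y => `|x - y|); split.
  split.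
    split=> [x y|x y|x y|x y z]; first exact: normr_ge0.
    - by split=> [/eqP|->]; rewrite ?subrr ?normr0// normr_eq0 subr_eq0 => /eqP.
    - exact: distrC.
    - exact: ler_distD.
  by move=> x V; split=> [/nbhs_ballP[r r0 h]|[r r0 h]]; [|apply/nbhs_ballP];
    exists r.
move=> u uC; suff : cvg (u @ \oo) by move=> h; exists (lim (u @ \oo)).
apply/cauchy_cvgP/cauchy_ballP => r /uC[N h].
pose U := u @` [set n | (N <= n)%N].
exists (U, U); first by split; exists N => // n Nn; exists n.
by move=> [_ _] [[m Nm <-] [n Nn <-]]; exact: h.
Qed.

Lemma polish_nat (R : realType) : polish R nat.
Proof.
split; first by exists setT; [exact: countableP|rewrite /dense => O O0 _; rewrite setIT].
exists (fun m n => (m != n)%:R); split.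
  split.
    split=> [m n|m n|m n|m n p]; first exact: ler0n.
    - by case: eqVneq => [->|/eqP mn]; split=> // /eqP; rewrite oner_eq0.
    - by rewrite eq_sym.
    - rewrite -natrD ler_nat; case: eqVneq => //= mp.
      by case: eqVneq => //= mn; rewrite -mn mp.
  move=> n V; split=> [nV|[r r0 h]].
    exists 1 => // m /=; case: eqVneq => [<- _|]; last by rewrite ltxx.
    exact: nbhs_singleton.
  apply: (filterS _ (discrete_set1 n)) => _ ->; apply: h => /=.
  by rewrite eqxx.
move=> u /(_ 1 ltr01)[N h]; exists (u N).
apply: cvg_near_cst; exists N => // n /= Nn; apply/esym/eqP.
by have := h N n (leqnn _) Nn; case: eqP => //=; rewrite ltxx.
Qed.

Lemma polish_prod (R : realType) (S T : topologicalType) :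
  polish R S -> polish R T -> polish R (S * T)%type.
Proof.
move=> [[D cD dD] [d [[[d0 dE dC dtri] nbd] dcomp]]].
move=> [[E cE dE'] [e [[[e0 eE eC etri] nbe] ecomp]]].
split.
  exists (D `*` E); first exact: countableX.
  move=> O [[x y] Oxy] oO.
  have [[U V] /= [Ux Vy] UVO] : nbhs (x, y) O by exact: open_nbhs_nbhs.
  have xU : U° !=set0 by exists x; exact: nbhs_singleton (nbhs_interior Ux).
  have [s []] := dD _ xU (open_interior _).
  move=> /interior_subset Us Ds.
  have yV : V° !=set0 by exists y; exact: nbhs_singleton (nbhs_interior Vy).
  have [t []] := dE' _ yV (open_interior _).
  move=> /interior_subset Vt Et.
  by exists (s, t); split=> //; exact: UVO.
exists (fun p q => d p.1 q.1 + e p.2 q.2); split.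
  split.
    split=> [p q|[x y] [x' y'] /=|p q|p q r].
    - by rewrite addr_ge0.
    - split=> [h|[-> ->]]; last by rewrite (dE _ _).2// (eE _ _).2// addr0.
      have hd := d0 x x'; have he := e0 y y'.
      by congr pair; [apply/dE|apply/eE]; lra.
    - by rewrite dC eC.
    - have := dtri p.1 q.1 r.1; have := etri p.2 q.2 r.2; lra.
  move=> [x y] O; split=> [[[U V] /= [/nbd[r r0 rU] /nbe[s s0 sV]] UVO]|[r r0 rO]].
    exists (Num.min r s); first by rewrite lt_min r0.
    move=> [x' y'] /=; rewrite lt_min => /andP[hr hs]; apply: UVO.
    have hd := d0 x x'; have he := e0 y y'.
    by split; [apply: rU|apply: sV] => /=; lra.
  exists ([set z | d x z < r / 2], [set z | e y z < r / 2]).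
    by split; [apply/nbd|apply/nbe]; exists (r / 2) => //; rewrite divr_gt0.
  by move=> [x' y'] /= [h1 h2]; apply: rO => /=; lra.
move=> u uC.
have [|l ul] := dcomp (fst \o u).
  move=> r /uC[N h]; exists N => m n Nm Nn /=.
  have he := e0 (u m).2 (u n).2; have := h m n Nm Nn; lra.
have [|l' ul'] := ecomp (snd \o u).
  move=> r /uC[N h]; exists N => m n Nm Nn /=.
  have hd := d0 (u m).1 (u n).1; have := h m n Nm Nn; lra.
exists (l, l').
have -> : u = fun n => ((u n).1, (u n).2) by apply/funext => n; case: (u n).
exact: cvg_pair.
Qed.

Lemma cantor_nbhsP (x : cantor_space) (V : set cantor_space) :
  nbhs x V <->
  exists N, [set y : cantor_space | forall i, (i < N)%N -> y i = x i] `<=` V.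
Proof.
pose C N := [set y : cantor_space | forall i, (i < N)%N -> y i = x i].
split; last first.
  move=> [N NV].
  suff CN : nbhs x (C N) by exact: filterS NV CN.
  elim: N {NV} => [|N IH]; first by apply: filterS filterT => y _ i.
  have : nbhs x [set y : cantor_space | y N = x N].
    have := @proj_continuous nat (fun=> bool) N x [set x N].
    by apply; exact: discrete_set1.
  apply: filterS2 IH => y h yN i; rewrite ltnS leq_eqVlt => /predU1P[->//|].
  exact: h.
have fF : Filter (filter_from setT C).
  apply: filter_from_filter; first by exists 0%N.
  move=> m n _ _; exists (maxn m n) => // y h.
  by split=> i im; apply: h; rewrite leq_max im ?orbT.
(* The filter generated by the cylinders converges to [x] in each coordinate, hence in the product
   topology. *)
suff : filter_from setT C --> x by move=> /[apply] -[N _ CV]; exists N.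
apply/cvg_sup => i U /= [_ [[W oW <-]] Wx WU].
exists i.+1 => // y /(_ i (ltnSn i)) yi; apply: WU.
by rewrite /= yi.
Qed.

Lemma polish_cantor (R : realType) : polish R cantor_space.
Proof.
pose N (x y : cantor_space) n := x n != y n.
(* The usual ultrametric, given by the first coordinate where the points differ. *)
pose d (x y : cantor_space) : R := if pselect (exists n, N x y n) is left h
  then 2^-1 ^+ ex_minn h else 0.
have pow0 n : (0 : R) < 2^-1 ^+ n by rewrite exprn_gt0// invr_gt0.
have powle m n : (m <= n)%N -> (2^-1 : R) ^+ n <= 2^-1 ^+ m.
  by move=> mn; apply: ler_wiXn2l => //; rewrite ?invr_ge0// invf_le1// ler1n.
have dcase x y : (x = y /\ d x y = 0) \/ exists m,
    [/\ x m != y m, forall i, (i < m)%N -> x i = y i & d x y = 2^-1 ^+ m].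
  rewrite /d; case: pselect => [h|nh].
    right; case: ex_minnP => m Nm min; exists m; split=> // i im.
    apply/eqP; apply: contraLR im => Ni; rewrite -leqNgt; exact: min.
  left; split=> //; apply/funext => i; apply: contrapT => /eqP Ni.
  by apply: nh; exists i.
have dge x y m : x m != y m -> 2^-1 ^+ m <= d x y.
  move=> xy; have [[xy' _]|[n [_ le ->]]] := dcase x y.
    by move: xy; rewrite xy' eqxx.
  apply: powle; rewrite leqNgt; apply/negP => /le xym.
  by move: xy; rewrite xym eqxx.
have dlt x y n : d x y < 2^-1 ^+ n -> forall i, (i <= n)%N -> x i = y i.
  move=> dn i ni; apply/eqP; apply: contraLR dn => /dge h; rewrite -leNgt.
  exact: le_trans (powle _ _ ni) h.
have dle x y n : (forall i, (i < n)%N -> x i = y i) -> d x y <= 2^-1 ^+ n.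
  move=> h; have [[_ ->]|[m [xym _ ->]]] := dcase x y; first exact: ltW.
  by apply: powle; rewrite leqNgt; apply/negP => /h mE; move: xym; rewrite mE eqxx.
have dxx x : d x x = 0.
  by have [[_ ->//]|[m []]] := dcase x x; rewrite eqxx.
have d0 x y : 0 <= d x y.
  by have [[_ ->]//|[m [_ _ ->]]] := dcase x y; exact: ltW.
have dsym x y : d x y <= d y x.
  have [[_ ->]|[m [xm _ ->]]] := dcase x y; first exact: d0.
  by apply: dge; rewrite eq_sym.
split.
  exists (range (fun (s : seq bool) => (nth false s : cantor_space))).
    exact: card_le_trans (card_image_le _ _) (countableP _).
  move=> O [x Ox] oO; have /cantor_nbhsP[n nO] := open_nbhs_nbhs (conj oO Ox).
  exists (nth false (mkseq x n)); split; last by exists (mkseq x n).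
  by apply: nO => i ni; rewrite nth_mkseq.
exists d; split.
  split.
    split=> // [x y|x y|x y z].
    - split=> [dxy|->//]; apply/funext => i; apply/eqP; apply: contraTT isT => /dge.
      by rewrite dxy leNgt pow0.
    - by apply/eqP; rewrite eq_le !dsym.
    - have [[_ ->]|[m [xm _ ->]]] := dcase x z; first by rewrite addr_ge0.
      have [xy|/dge xy] := eqVneq (x m) (y m).
        by rewrite xy in xm; have := dge _ _ _ xm; have := d0 x y; lra.
      by have := d0 y z; lra.
  move=> x V; split=> [/cantor_nbhsP[n nV]|[r r0 rV]].
    exists (2^-1 ^+ n) => // y /= /dlt h; apply: nV => i ni.
    by rewrite h// ltnW.
  have [n nr] := expr_half_lt r0; apply/cantor_nbhsP; exists n => y h; apply: rV => /=.
  by apply: le_lt_trans nr; apply: dle => i ni; rewrite h.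
move=> u uC.
(* From [M n] on, coordinate [n] no longer changes; the limit is read off these values. *)
have /choice[M MP] n : exists M, forall m, (M <= m)%N -> u m n = u M n.
  have [M MP] := uC _ (pow0 n); exists M => m Mm.
  exact: dlt (MP _ _ Mm (leqnn _)) _ (leqnn n).
exists (fun n => u (M n) n) => V /cantor_nbhsP[n nV].
exists (\max_(i < n) M i)%N => // m /= nm; apply: nV => i ni; apply: MP.
by apply: leq_trans nm; exact: (leq_bigmax (Ordinal ni)).
Qed.

(** This form covers both target graphs. The parameter space is [nat * Y]: the half of the number
    selects the map, and its parity tells whether to swap. *)
Lemma analytic_symmetric_bigcup (R : realType) (X Y : topologicalType)
    (f : nat -> Y -> X * X) : polish R Y -> (forall n, continuous (f n)) ->
  analytic R [set p | exists n y, f n y = p \/ f n y = (p.2, p.1)].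
Proof.
move=> pY cf.
pose F (q : nat * Y) : X * X :=
  let p := f q.1./2 q.2 in if odd q.1 then (p.2, p.1) else p.
exists (nat * Y)%type; split; first exact: polish_prod (polish_nat R) pY.
exists F.
  move=> [n y] V FV.
  have [U Uy UV] : exists2 U, nbhs y U & forall z, U z -> V (F (n, z)).
    move: FV; rewrite /F /=; case: (odd n) => FV.
      exists ((fun z => ((f n./2 z).2, (f n./2 z).1)) @^-1` V) => //.
      have : (fun z => ((f n./2 z).2, (f n./2 z).1)) @ y --> ((f n./2 y).2, (f n./2 y).1).
        apply: cvg_pair.
          by apply: (continuous_comp (@cf n./2 y)); exact: cvg_snd.
        by apply: (continuous_comp (@cf n./2 y)); exact: cvg_fst.
      exact.
    by exists (f n./2 @^-1` V) => //; exact: cf.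
  exists ([set n], U); first by split=> //; exact: discrete_set1.
  by move=> [m z] /= [-> Uz]; exact: UV.
apply/seteqP; split=> [_ [[n y] _ <-]|[p1 p2] [n [y]]].
  exists n./2, y; rewrite /F /=; case: odd; last by left.
  by right; rewrite /=; case: (f n./2 y).
move=> [fE|fE].
  by exists (n.*2, y) => //; rewrite /F /= odd_double doubleK.
by exists (n.*2.+1, y) => //; rewrite /F /= odd_double/= uphalf_double fE.
Qed.

(** * Analytic independent sets *)

(* First reflection theorem for the family of analytic rectangles avoiding an
   analytic relation, proved as Lusin's separation theorem is: if no Borel
   rectangle works for [(P, Q, P')] then this is so for arbitrarily small pieces
   of [P], [Q] and [P'], which shrink to three points where it fails. *)
Section reflection.
Variables (R : realType) (X Y : topologicalType).
Variables (g1 g2 : Y -> X) (f : Y -> X * X).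
Hypotheses (pX : polish R X) (pY : polish R Y).
Hypotheses (cg1 : continuous g1) (cg2 : continuous g2) (cf : continuous f).

(** Stated for sets of parameters in [Y], so that all three can be cut by small balls of its
    complete metric. *)
Definition borel_separated (P Q P' : set Y) := exists B1 B2 : set X,
  [/\ borel B1, borel B2, g1 @` P `<=` B1, g2 @` P' `<=` B2 &
      forall y, Q y -> ~ (B1 (f y).1 /\ B2 (f y).2)].

(** Rectangles for the pieces are glued by uniting the first sides and intersecting the second ones:
    a point of the result lies in the rectangle of some piece. *)
Lemma borel_separated_split1 P Q P' (C : nat -> set Y) :
  \bigcup_k C k = setT -> ~ borel_separated P Q P' ->
  exists k, ~ borel_separated (P `&` C k) Q P'.
Proof.
move=> CT; apply: contra_notP => /forallNP h.
have /choice[B1 /choice[B2 BP]] k : exists B1 B2 : set X,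
  [/\ borel B1, borel B2, g1 @` (P `&` C k) `<=` B1, g2 @` P' `<=` B2 &
      forall y, Q y -> ~ (B1 (f y).1 /\ B2 (f y).2)] by apply: contrapT; exact: h.
exists (\bigcup_k B1 k), (\bigcap_k B2 k); split.
- by apply: borel_bigcup => k; have [] := BP k.
- by apply: borel_bigcap => k; have [] := BP k.
- move=> _ [y Py <-]; have [k _ Cy] : (\bigcup_k C k) y by rewrite CT.
  by exists k => //; have [_ _ + _ _] := BP k; apply; exists y.
- by move=> x P'x k _; have [_ _ _ + _] := BP k; exact.
- move=> y Qy [[k _ By] B2y]; have [_ _ _ _ /(_ y Qy)] := BP k; apply; split=> //.
  exact: B2y.
Qed.

Lemma borel_separated_split3 P Q P' (C : nat -> set Y) :
  \bigcup_k C k = setT -> ~ borel_separated P Q P' ->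
  exists k, ~ borel_separated P Q (P' `&` C k).
Proof.
move=> CT; apply: contra_notP => /forallNP h.
have /choice[B1 /choice[B2 BP]] k : exists B1 B2 : set X,
  [/\ borel B1, borel B2, g1 @` P `<=` B1, g2 @` (P' `&` C k) `<=` B2 &
      forall y, Q y -> ~ (B1 (f y).1 /\ B2 (f y).2)] by apply: contrapT; exact: h.
exists (\bigcap_k B1 k), (\bigcup_k B2 k); split.
- by apply: borel_bigcap => k; have [] := BP k.
- by apply: borel_bigcup => k; have [] := BP k.
- by move=> x Px k _; have [_ _ + _ _] := BP k; exact.
- move=> _ [y Py <-]; have [k _ Cy] : (\bigcup_k C k) y by rewrite CT.
  by exists k => //; have [_ _ _ + _] := BP k; apply; exists y.
- move=> y Qy [B1y [k _ By]]; have [_ _ _ _ /(_ y Qy)] := BP k; apply; split=> //.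
  exact: B1y.
Qed.

(** Here both sides are intersected, so that the rectangle avoids the image of every piece of
    [Q]. *)
Lemma borel_separated_split2 P Q P' (C : nat -> set Y) :
  \bigcup_k C k = setT -> ~ borel_separated P Q P' ->
  exists k, ~ borel_separated P (Q `&` C k) P'.
Proof.
move=> CT; apply: contra_notP => /forallNP h.
have /choice[B1 /choice[B2 BP]] k : exists B1 B2 : set X,
  [/\ borel B1, borel B2, g1 @` P `<=` B1, g2 @` P' `<=` B2 &
      forall y, (Q `&` C k) y -> ~ (B1 (f y).1 /\ B2 (f y).2)].
  by apply: contrapT; exact: h.
exists (\bigcap_k B1 k), (\bigcap_k B2 k); split.
- by apply: borel_bigcap => k; have [] := BP k.
- by apply: borel_bigcap => k; have [] := BP k.
- by move=> x Px k _; have [_ _ + _ _] := BP k; exact.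
- by move=> x P'x k _; have [_ _ _ + _] := BP k; exact.
- move=> y Qy [B1y B2y]; have [k _ Cy] : (\bigcup_k C k) y by rewrite CT.
  have [_ _ _ _ /(_ y)] := BP k; apply; first by split.
  by split; [exact: B1y|exact: B2y].
Qed.

Lemma reflection (P P' : set Y) : closed P -> closed P' ->
  (forall y p p', P p -> P' p' -> f y <> (g1 p, g2 p')) ->
  borel_separated P setT P'.
Proof.
move=> clP clP' PP'; apply: contrapT => nsep.
(* An empty [P1] or [P1'] is separated by an empty side, an empty [Q1] by the whole square. *)
have ne P1 Q1 P1' : ~ borel_separated P1 Q1 P1' ->
    [/\ P1 !=set0, Q1 !=set0 & P1' !=set0].
  move=> ns; split; apply/set0P/eqP => E; apply: ns; rewrite E.
  - by exists set0, setT; split=> //; [exact: borel0|exact: borelT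
      |rewrite image_set0|move=> y _ []].
  - by exists setT, setT; split=> //; exact: borelT.
  - by exists setT, set0; split=> //; [exact: borelT|exact: borel0
      |rewrite image_set0|move=> y _ []].
have [[y0 _] _ _] := ne _ _ _ nsep.
have [sY [d [md dcomp]]] := pY; have [_ [d' [md' _]]] := pX.
have [a aP] := separable_seq md sY y0.
pose C n k := [set y | d (a k) y < 2^-1 ^+ n].
have CT n : \bigcup_k C n k = setT.
  apply/seteqP; split=> // y _; have [|k] := aP y (2^-1 ^+ n).
    by rewrite exprn_gt0// invr_gt0.
  by move=> h; exists k.
pose bad (S : set Y * set Y * set Y) := ~ borel_separated S.1.1 S.1.2 S.2.
pose step n (S S' : set Y * set Y * set Y) := exists k1 k2 k3,
  S' = (S.1.1 `&` C n k1, S.1.2 `&` C n k2, S.2 `&` C n k3).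
have badstep n (S : {S | bad S}) : exists S' : {S | bad S}, step n (sval S) (sval S').
  case: S => [[[P1 Q1] P1'] bS] /=.
  have [k1 h1] := borel_separated_split1 (CT n) bS.
  have [k2 h2] := borel_separated_split2 (CT n) h1.
  have [k3 h3] := borel_separated_split3 (CT n) h2.
  by exists (exist _ (P1 `&` C n k1, Q1 `&` C n k2, P1' `&` C n k3) h3), k1, k2, k3.
have [s sP] : exists s : nat -> {S | bad S}, sval (s 0%N) = (P, setT, P') /\
    forall n, step n (sval (s n)) (sval (s n.+1)).
  have /choice[F FP] := fun nS : nat * {S | bad S} => badstep nS.1 nS.2.
  pose S0 : {S | bad S} := exist _ (P, setT, P') nsep.
  exists (fix s n := if n is m.+1 then F (m, s m) else S0); split=> // n.
  exact: FP (n, _).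
(* The shift puts the sets of [S n] inside balls of radius [2^-1 ^+ n], step [n] being already
   done. *)
pose S n := sval (s n.+1).
have /choice[k1 /choice[k2 /choice[k3 kE]]] : forall n, exists k1 k2 k3,
  S n = ((sval (s n)).1.1 `&` C n k1, (sval (s n)).1.2 `&` C n k2,
         (sval (s n)).2 `&` C n k3) by move=> n; exact: sP.2.
have badS n : bad (S n) := svalP (s n.+1).
have [l1 l1P] : exists l : Y, forall U, nbhs l U -> exists n, (S n).1.1 `<=` U.
  apply: (cantor_intersection md dcomp (a := fun n => a (k1 n))) => n.
  - by have [] := ne _ _ _ (badS n).
  - by rewrite [S n.+1]kE; exact: subIsetl.
  - by rewrite kE; exact: subIsetr.
have [l2 l2P] : exists l : Y, forall U, nbhs l U -> exists n, (S n).1.2 `<=` U.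
  apply: (cantor_intersection md dcomp (a := fun n => a (k2 n))) => n.
  - by have [] := ne _ _ _ (badS n).
  - by rewrite [S n.+1]kE; exact: subIsetl.
  - by rewrite kE; exact: subIsetr.
have [l3 l3P] : exists l : Y, forall U, nbhs l U -> exists n, (S n).2 `<=` U.
  apply: (cantor_intersection md dcomp (a := fun n => a (k3 n))) => n.
  - by have [] := ne _ _ _ (badS n).
  - by rewrite [S n.+1]kE; exact: subIsetl.
  - by rewrite kE; exact: subIsetr.
have SP n : (S n).1.1 `<=` P /\ (S n).2 `<=` P'.
  elim: n => [|n [IH1 IH2]]; rewrite kE /=.
    by rewrite sP.1; split; exact: subIsetl.
  by split; apply: subset_trans (@subIsetl _ _ _) _.
have Sle m n : (m <= n)%N ->
    [/\ (S n).1.1 `<=` (S m).1.1, (S n).1.2 `<=` (S m).1.2 & (S n).2 `<=` (S m).2].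
  elim: n => [|n IH]; first by rewrite leqn0 => /eqP ->; split=> ?.
  rewrite leq_eqVlt => /predU1P[->|]; first by split=> ?.
  rewrite ltnS => /IH[h1 h2 h3].
  rewrite [S n.+1]kE; split; apply: subset_trans (@subIsetl _ _ _) _ => //.
have Pl1 : P l1.
  apply: contrapT => nP.
  have [n nS] := l1P _ (open_nbhs_nbhs (conj (closed_openC clP) nP)).
  have [[y Sy] _ _] := ne _ _ _ (badS n); exact: nS _ Sy ((SP n).1 _ Sy).
have P'l3 : P' l3.
  apply: contrapT => nP.
  have [n nS] := l3P _ (open_nbhs_nbhs (conj (closed_openC clP') nP)).
  have [_ _ [y Sy]] := ne _ _ _ (badS n); exact: nS _ Sy ((SP n).2 _ Sy).
(* By hypothesis [f l2] is not [(g1 l1, g2 l3)]. Disjoint open sets around the coordinates that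
   differ yield a rectangle, open on one side and full on the other, that separates a late bad
   triple. *)
have [fl1|fl1] := pselect ((f l2).1 = g1 l1); last first.
  have [U [V [oU oV Ux Vx UV]]] := metric_separation md' fl1.
  have [n nS] : exists n, (S n).1.1 `<=` g1 @^-1` V.
    by apply: l1P; apply: cg1; exact: open_nbhs_nbhs.
  have [m mS] : exists n, (S n).1.2 `<=` (fst \o f) @^-1` U.
    apply: l2P; apply: (continuous_comp (@cf l2)); first exact: cvg_fst.
    exact: open_nbhs_nbhs.
  apply: (badS (maxn m n)); exists V, setT; split.
  - exact: borel_open.
  - exact: borelT.
  - by have [h _ _] := Sle _ _ (leq_maxr m n); move=> _ [y /h/nS Vy <-].
  - by [].
  - move=> y Sy [Vy _]; have [_ /(_ _ Sy)/mS Uy _] := Sle _ _ (leq_maxl m n).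
    by have : (U `&` V) (f y).1 by []; rewrite UV.
have [fl2|fl2] := pselect ((f l2).2 = g2 l3).
  by apply: (PP' l2 l1 l3) => //; rewrite -fl1 -fl2; case: (f l2).
have [U [V [oU oV Ux Vx UV]]] := metric_separation md' fl2.
have [n nS] : exists n, (S n).2 `<=` g2 @^-1` V.
  by apply: l3P; apply: cg2; exact: open_nbhs_nbhs.
have [m mS] : exists n, (S n).1.2 `<=` (snd \o f) @^-1` U.
  apply: l2P; apply: (continuous_comp (@cf l2)); first exact: cvg_snd.
  exact: open_nbhs_nbhs.
apply: (badS (maxn m n)); exists setT, V; split.
- exact: borelT.
- exact: borel_open.
- by [].
- by have [_ _ h] := Sle _ _ (leq_maxr m n); move=> _ [y /h/nS Vy <-].
- move=> y Sy [_ Vy]; have [_ /(_ _ Sy)/mS Uy _] := Sle _ _ (leq_maxl m n).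
  by have : (U `&` V) (f y).2 by []; rewrite UV.
Qed.

End reflection.

(** * A triangle-free graph on the line *)

Section translations.
Variable R : realType.
Local Notation mu := (@lebesgue_measure R).

Lemma measurable_translation (t : R) :
  measurable_fun setT ((fun x => x + t) : measurableTypeR R -> measurableTypeR R).
Proof. apply: continuous_measurable_fun => x.
by apply: cvgD; [exact: cvg_id|exact: cvg_cst]. Qed.

(** Uniqueness of Lebesgue measure: the pushforward gives half-open intervals their lengths. *)
Lemma lebesgue_measure_translation (t : R) (A : set R) : measurable A ->
  pushforward mu ((fun x => x + t) : _ -> measurableTypeR R) A = mu A.
Proof.
move=> mA; apply/esym/lebesgue_measure_unique => //=.
  exact: measurable_translation.
move=> mf _ [[a b]] _ <-; rewrite /pushforward/=.
have -> : (fun x => x + t) @^-1` `]a, b] = `]a - t, b - t]%classic.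
  by apply/seteqP; split=> x /=; rewrite !in_itv/= ltrBlDr lerBrDr.
rewrite !lebesgue_measure_itv/= !lte_fin ltrD2r -!EFinB.
by rewrite opprB addrA subrK.
Qed.

(** Take [K] compact in [E] and [U] open around [K], with the rest of [U] smaller than [K]. A small
    translate of [K] stays in [U], and is too large to avoid [K]. *)
Lemma steinhaus (E : set R) : measurable E -> (0 < mu E)%E -> (mu E < +oo)%E ->
  \forall t \near (0 : R), exists x, E x /\ E (x + t).
Proof.
move=> mE E0 Eoo.
have fE : mu E \is a fin_num by rewrite ge0_fin_numE.
(* An error below [mu E] suffices for [K] to have positive measure. *)
have [|K [cK KE EK]] := @lebesgue_regularity_inner R E (fine (mu E)) mE Eoo.
  by rewrite fine_gt0// E0.
have mK : measurable K by exact: compact_measurable.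
have K0 : (0 < mu K)%E.
  rewrite lt_neqAle measure_ge0 andbT; apply/eqP => K0.
  have EDK : mu E = (mu (E `\` K) + mu (E `&` K))%E by exact: measureDI.
  have EK' : (mu E <= mu (E `\` K))%E by rewrite EDK (setIidr KE) -K0 adde0.
  by have := le_lt_trans EK' EK; rewrite fineK// ltxx.
have Koo : (mu K < +oo)%E.
  by apply: le_lt_trans Eoo; apply: le_measure; rewrite ?inE.
have fK : mu K \is a fin_num by rewrite ge0_fin_numE.
have [|U [oU KU UK]] := @lebesgue_regularity_outer R K (fine (mu K)) mK Koo.
  by rewrite fine_gt0// K0.
have mU : measurable U by exact: open_measurable.
have : \forall t \near (0 : R), K `<=` [set x | U (x - t)].
  apply: ((compact_near_coveringP K).1 cK R (nbhs (0 : R)) (fun t x => U (x - t)) _).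
  move=> x Kx.
  have : (fun p : R * R => p.1 - p.2) @ (x, 0) --> x - 0.
    by apply: cvgB; [exact: cvg_fst|exact: cvg_snd].
  by apply; apply: open_nbhs_nbhs; split=> //; rewrite subr0; exact: KU.
apply: filterS => t Kt; apply: contrapT => /forallNP nE.
move: UK; apply/negP; rewrite -leNgt fineK//.
rewrite -(lebesgue_measure_translation t mK) /pushforward.
apply: le_measure; rewrite ?inE.
- rewrite -[X in measurable X]setTI.
  exact: measurable_translation.
- exact: measurableD.
- move=> x /= Kxt; split; first by have := Kt _ Kxt; rewrite /= addrK.
  by move=> Kx; apply: (nE x); split; exact: KE.
Qed.

End translations.

Section power3_graph.
Variable R : realType.

Definition power3_graph : set (R * R) :=
  [set p : R * R | exists n, p.2 = p.1 + 3^-1 ^+ n \/ p.1 = p.2 + 3^-1 ^+ n].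

Lemma is_graph_power3_graph : is_graph power3_graph.
Proof.
split=> [x|x y] /= [n].
  have p : (0 : R) < 3^-1 ^+ n by rewrite exprn_gt0// invr_gt0.
  by case=> h; move: p; lra.
by move=> [h|h]; exists n; [right|left].
Qed.

(** Powers of 3 are odd. The claim is for all large [M] so that several edges can be brought to one
    scale. *)
Lemma power3_graph_odd x y : power3_graph (x, y) ->
  exists N, forall M, (N <= M)%N -> exists k : int, (x - y) * 3 ^+ M = (2 * k + 1)%:~R.
Proof.
move=> [n /= xy]; exists n => M nM.
have pow3 m : exists k : int, 3 ^+ m = (2 * k + 1)%:~R :> R.
  elim: m => [|m [k IH]]; first by exists 0; rewrite expr0.
  by exists (3 * k + 1); rewrite exprS IH -[3]/(3%:~R) -intrM; congr (_%:~R); ring.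
have E : (3^-1 : R) ^+ n * 3 ^+ M = 3 ^+ (M - n).
  by rewrite -{1}(subnK nM) exprD mulrCA exprVn mulVf ?mulr1// expf_neq0.
have [k kE] := pow3 (M - n)%N.
case: xy => ->.
  exists (- k - 1); rewrite opprD addrA subrr sub0r mulNr E kE -mulrNz.
  by congr (_%:~R); ring.
by exists k; rewrite addrC addKr E kE.
Qed.

(** At a common scale, one side would be an odd number equal to the sum of two odd numbers. *)
Lemma power3_graph_triangle_free x y z :
  power3_graph (x, y) -> power3_graph (y, z) -> power3_graph (x, z) -> False.
Proof.
move=> /power3_graph_odd[N1 h1] /power3_graph_odd[N2 h2] /power3_graph_odd[N3 h3].
pose M := (N1 + N2 + N3)%N.
have [|k1 E1] := h1 M; first by rewrite /M; lia.
have [|k2 E2] := h2 M; first by rewrite /M; lia.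
have [|k3 E3] := h3 M; first by rewrite /M; lia.
have : ((2 * k1 + 1) + (2 * k2 + 1))%:~R = (2 * k3 + 1)%:~R :> R.
  by rewrite intrD -E1 -E2 -E3; ring.
by move=> /intr_inj; lia.
Qed.

Lemma power3_graph_not_colorable : ~ has_countable_borel_coloring power3_graph.
Proof.
move=> [c bc cP].
(* One of these sets has positive measure, finite thanks to the unit interval, so [steinhaus] finds
   in it two points at distance [3^-1 ^+ k]. *)
pose E n : set R := c @^-1` [set n] `&` `[0, 1].
have mE n : measurable (E n).
  apply: measurableI; last exact: measurable_itv.
  have : borel (c @^-1` [set n]) by apply: bc; apply: borel_open; exact: discrete_open.
  apply: smallest_sub; first exact: sigma_algebra_measurable.
  by move=> U oU; exact: open_measurable.
have l01 : (@lebesgue_measure R) `[0, 1]%classic = 1%E.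
  by rewrite lebesgue_measure_itv/= lte_fin ltr01 -EFinB subr0.
have [n En] : exists n, (0 < (@lebesgue_measure R) (E n))%E.
  apply: contrapT => /forallNP h.
  have : (@lebesgue_measure R).-negligible (\bigcup_n E n).
    apply: negligible_bigcup => n; apply/negligibleP; first exact: mE.
    by apply/eqP; rewrite -measure_le0 leNgt; apply/negP/h.
  have -> : \bigcup_n E n = `[0, 1]%classic.
    by apply/seteqP; split=> [x [n _ []]//|x x01]; exists (c x).
  move=> /negligibleP h0.
  have : (@lebesgue_measure R) `[0, 1]%classic = 0%E.
    by apply: h0; exact: measurable_itv.
  by rewrite l01 => /eqP; rewrite eqe oner_eq0.
have Eoo : ((@lebesgue_measure R) (E n) < +oo)%E.
  apply: (@le_lt_trans _ _ ((@lebesgue_measure R) `[0, 1]%classic)).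
    apply: le_measure; last exact: subIsetr.
      by apply: mem_set; exact: mE.
    by apply: mem_set; exact: measurable_itv.
  by rewrite l01 ltry.
have : (fun k => 3^-1 ^+ k : R) @ \oo --> (0 : R).
  by apply: cvg_expr; rewrite ger0_norm ?invr_ge0// invf_lt1// ltr1n.
move=> /(_ _ (steinhaus (mE n) En Eoo))[k _ /(_ k (leqnn k))].
move=> [x [[/= cx _] [/= cxk _]]].
apply: (cP x (x + 3^-1 ^+ k)); last by rewrite cx cxk.
by exists k; left.
Qed.

End power3_graph.

(** * The graph of cuts *)

Section cuts.
Variables (R : realType) (e : nat -> R).

Definition lower_cut (i : nat) (V : nat -> bool) : nat -> bool :=
  fun j => V j && (e j < e i).

Definition cut_graph : set ((nat -> bool) * (nat -> bool)) :=
  [set p : (nat -> bool) * (nat -> bool) | exists i,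
    (p.1 i /\ p.2 = lower_cut i p.1) \/ (p.2 i /\ p.1 = lower_cut i p.2)].

Lemma lower_cut_lower_cut i k V : e i <= e k ->
  lower_cut i (lower_cut k V) = lower_cut i V.
Proof.
move=> ik; apply/funext => j; rewrite /lower_cut -andbA; congr andb.
by apply/andb_idl => ji; exact: lt_le_trans ji ik.
Qed.

Lemma is_graph_cut_graph : is_graph cut_graph.
Proof.
split=> [V|V W] /=.
  by move=> [i [] /= [Vi VE]]; move: Vi; rewrite VE /lower_cut ltxx andbF.
by move=> [i [H|H]]; exists i; [right|left].
Qed.

(** A geometric series restricted to [K], written as a supremum of partial sums. It turns growing
    sets of colors into increasing reals. *)
Definition weight (K : set nat) : R :=
  sup [set \sum_(n < N) (if `[< K n >] then 2^-1 ^+ n else 0) | N in setT].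

Lemma weight_lt K L n : K `<=` L -> L n -> ~ K n ->
  weight K + 2^-1 ^+ n <= weight L.
Proof.
move=> KL Ln nKn.
pose s (M : set nat) N : R := \sum_(n < N) (if `[< M n >] then 2^-1 ^+ n else 0).
(* The term in [N] carries the induction; the bound 2 makes the suprema finite. *)
have s2 M N : s M N <= 2 - 2 * 2^-1 ^+ N.
  elim: N => [|N IH]; first by rewrite /s big_ord0 expr0 mulr1 subrr.
  have p : (0 : R) <= 2^-1 ^+ N by rewrite exprn_ge0// invr_ge0.
  rewrite /s big_ord_recr /= -/(s M N) exprS; case: ifP => _; lra.
have s2' M N : s M N <= 2.
  by apply: le_trans (s2 M N) _; rewrite lerBlDr lerDl mulr_ge0// exprn_ge0// invr_ge0.
have supS M N : s M N <= weight M.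
  apply: ub_le_sup; last by exists N.
  by exists 2 => _ [k _ <-]; exact: s2'.
rewrite -lerBrDr; apply: ge_sup; first by exists (s K 0%N), 0%N.
move=> _ [N _ <-]; rewrite lerBrDr -/(s K N).
(* This many terms include the term [n], which counts for [L] only. *)
have := supS L (N + n.+1)%N; apply: le_trans.
have sN : s K N <= s K (N + n.+1)%N.
  rewrite /s big_split_ord /= lerDl; apply: sumr_ge0 => i _.
  by case: ifP => // _; rewrite exprn_ge0// invr_ge0.
apply: (@le_trans _ _ (s K (N + n.+1)%N + 2^-1 ^+ n)); first by rewrite lerD2r.
have nN : (n < N + n.+1)%N by rewrite addnS ltnS leq_addl.
rewrite /s (bigD1 (Ordinal nN))//= asboolF// add0r addrC.
rewrite [leRHS](bigD1 (Ordinal nN))//= asboolT// lerD2l.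
apply: ler_sum => i _; case: asboolP => Ki; first by rewrite asboolT//; exact: KL.
by case: ifP => // _; rewrite exprn_ge0// invr_ge0.
Qed.

Hypothesis dense_e : forall a b : R, a < b -> exists i, a < e i < b.

(** If [W] is the cut of [V] at one of its points, [c W] is in [K V] but not in [K W], so the weight
    grows by at least [2^-1 ^+ c W]. The point [e (g W)] is chosen within that gain, hence the
    choices always move up and a maximal chain of them could be prolonged. *)
Lemma cut_graph_not_colorable (c : (nat -> bool) -> nat) :
  ~ forall V W, cut_graph (V, W) -> c V <> c W.
Proof.
move=> cP.
have cutP (V : nat -> bool) i : V i -> c (lower_cut i V) <> c V.
  by move=> Vi; apply: cP; exists i; right.
pose K (V : nat -> bool) : set nat := [set c (lower_cut i V) | i in [set i | V i]].
have gex V : exists i, weight (K V) < e i < weight (K V) + 2^-1 ^+ c V.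
  by apply: dense_e; rewrite ltrDl exprn_gt0// invr_gt0.
pose g V := projT1 (cid (gex V)).
have gP V : weight (K V) < e (g V) < weight (K V) + 2^-1 ^+ c V.
  exact: (projT2 (cid (gex V))).
pose good (V : nat -> bool) := forall i, V i -> i = g (lower_cut i V).
(* [good V]: every point of [V] is the one that [g] chooses after those below. *)
have good_lt (V : nat -> bool) i : good V -> V i -> e i < e (g V).
  move=> gV Vi; have /andP[+ _] := gP V; apply: le_lt_trans.
  (* [i] was chosen by [g] for the cut below it, which puts [e i] under [weight (K V)]. *)
  rewrite [in leLHS](gV _ Vi); have /andP[_ /ltW] := gP (lower_cut i V).
  move=> /le_trans; apply; apply: weight_lt.
  - move=> _ [j /andP[Vj ji] <-]; exists j => //.
    by rewrite lower_cut_lower_cut// ltW.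
  - by exists i.
  - move=> [j /andP[Vj ji]]; rewrite lower_cut_lower_cut//; last exact: ltW.
    have cj : lower_cut i V j by rewrite /lower_cut Vj.
    by have := cutP _ _ cj; rewrite lower_cut_lower_cut//; exact: ltW.
(* End-extension, for the order given by the values of [e]. *)
pose ext (V W : nat -> bool) := forall i, V i -> W i /\ lower_cut i V = lower_cut i W.
pose tower (F : set (nat -> bool)) :=
  (forall V, F V -> good V) /\
  (forall V W, F V -> F W -> ext V W \/ ext W V).
have [F [[Fgood Ftot] Fmax]] : exists F, tower F /\ forall G, F `<` G -> ~ tower G.
  apply: Zorn_bigcup => FF FFt FFtot; split=> [V [F FFF FV]|V W [F1 h1 F1V] [F2 h2 F2W]].
    exact: (FFt _ FFF).1.
  have [le12|le21] := FFtot _ _ h1 h2.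
    by apply: (FFt _ h2).2 => //; exact: le12.
  by apply: (FFt _ h1).2 => //; exact: le21.
(* The union of the maximal tower is good and end-extends each member; [g V] can then be put on top
   of it. *)
pose V i := `[< exists2 W, F W & W i >].
have extV W : F W -> ext W V.
  move=> FW i Wi; have Vi : V i by apply/asboolP; exists W.
  split=> //; apply/funext => j; rewrite /lower_cut.
  case: ltP => ji; rewrite ?andbT ?andbF//.
  apply/idP/asboolP => [Wj|[W' FW' W'j]]; first by exists W.
  have [h|h] := Ftot _ _ FW FW'.
    have [_ /(congr1 (@^~ j))] := h _ Wi.
    by rewrite /lower_cut ji !andbT => ->.
  by have [] := h _ W'j.
have goodV : good V.
  move=> i /asboolP[W FW Wi]; rewrite {1}(Fgood _ FW _ Wi).
  by have [_ ->] := extV _ FW _ Wi.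
pose V' i := V i || (i == g V).
have extV' : ext V V'.
  move=> i Vi; split; first by rewrite /V' Vi.
  apply/funext => j; rewrite /lower_cut /V'; case: eqP => [->|]; last by rewrite orbF.
  by rewrite orbT/= [e (g V) < _]ltNge ltW ?andbF//; exact: good_lt.
have cutV' : lower_cut (g V) V' = V.
  apply/funext => j; rewrite /lower_cut /V'; case: eqP => [->|_]; last first.
    by rewrite orbF; apply/andb_idr => Vj; exact: good_lt.
  rewrite ltxx andbF; apply/esym/negP => Vg.
  by have := good_lt _ _ goodV Vg; rewrite ltxx.
have goodV' : good V'.
  move=> i /orP[Vi|/eqP ->]; last by rewrite cutV'.
  by rewrite -(extV' _ Vi).2 -goodV.
have gV'V : ~ F V'.
  move=> FV'; have /(extV _ FV')[Vg _] : V' (g V) by rewrite /V' eqxx orbT.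
  by have := good_lt _ _ goodV Vg; rewrite ltxx.
apply: (Fmax (F `|` [set V'])).
  split; first by move=> W FW; left.
  by move=> /(_ V') h; apply: gV'V; apply: h; right.
have extFV' W : F W -> ext W V'.
  move=> FW i Wi; have [Vi ->] := extV _ FW _ Wi.
  exact: extV'.
have ext_refl W : ext W W by move=> i.
split=> [W [/Fgood//|->//]|W1 W2 [F1|->] [F2|->]].
- exact: Ftot.
- by left; exact: extFV'.
- by right; exact: extFV'.
- by left.
Qed.

End cuts.

(** * The dichotomy fails *)

Lemma analytic_power3_graph (R : realType) : analytic R (@power3_graph R).
Proof.
have -> : @power3_graph R = [set p | exists n y,
    (y, y + 3^-1 ^+ n) = p \/ (y, y + 3^-1 ^+ n) = (p.2, p.1)].
  apply/seteqP; split=> [[x y] [n /= [->|->]]|[x y] [n [z [[<- <-]|[<- <-]]]]].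
  - by exists n, x; left.
  - by exists n, y; right.
  - by exists n; left.
  - by exists n; right.
pose f n (y : R) := (y, y + 3^-1 ^+ n).
apply: (@analytic_symmetric_bigcup R R R f (polish_real R)) => n y.
apply: (@cvg_pair R R R (nbhs y) (nbhs y) (nbhs (y + 3^-1 ^+ n))).
  exact: cvg_id.
by apply: cvgD; [exact: cvg_id|exact: cvg_cst].
Qed.

Lemma continuous_cantor (T : topologicalType) (f : T -> cantor_space) x :
  (forall i, exists2 U, nbhs x U & forall y, U y -> f y i = f x i) ->
  f @ x --> f x.
Proof.
move=> fU V /cantor_nbhsP[N NV].
suff : nbhs x [set y | forall i, (i < N)%N -> f y i = f x i].
  by apply: filterS => y h; exact: NV.
elim: N {NV} => [|N IH]; first by apply: filterS filterT => y _ i.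
have [U xU Uf] := fU N.
apply: filterS2 IH xU => y h /Uf yN i; rewrite ltnS leq_eqVlt => /predU1P[->//|].
exact: h.
Qed.

Lemma cantor_coordinate_nbhs (V : cantor_space) j :
  nbhs V [set W : cantor_space | W j = V j].
Proof. by apply/cantor_nbhsP; exists j.+1 => W; exact. Qed.

Lemma continuous_cut (R : realType) (e : nat -> R) i :
  continuous (lower_cut e i : cantor_space -> cantor_space).
Proof.
move=> V; apply: continuous_cantor => j.
exists [set W : cantor_space | W j = V j]; first exact: cantor_coordinate_nbhs.
by move=> W /= Wj; rewrite /lower_cut Wj.
Qed.

Lemma analytic_cut_graph (R : realType) (e : nat -> R) :
  analytic R (cut_graph e : set (cantor_space * cantor_space)).
Proof.
(* Adding [i] to an arbitrary [V] makes the parametrization total. *)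
pose add i (V : cantor_space) : cantor_space := fun j => (j == i) || V j.
have -> : (cut_graph e : set (cantor_space * cantor_space)) =
    [set p | exists i V, (add i V, lower_cut e i V) = p \/
                         (add i V, lower_cut e i V) = (p.2, p.1)].
  have addE i (V : cantor_space) : V i -> add i V = V.
    by move=> Vi; apply/funext => j; rewrite /add; case: eqP => [->|].
  have cutE i V : lower_cut e i (add i V) = lower_cut e i V.
    apply/funext => j; rewrite /lower_cut /add; case: eqP => [->|//].
    by rewrite ltxx !andbF.
  apply/seteqP; split=> [[V W] [i /= [[Vi ->]|[Wi ->]]]|
                         [V W] [i [U [[<- <-]|[<- <-]]]]].
  - by exists i, V; left; rewrite addE.
  - by exists i, W; right; rewrite addE.
  - by exists i; left; rewrite /= cutE /add eqxx.
  - by exists i; right; rewrite /= cutE /add eqxx.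
pose f i (V : cantor_space) : cantor_space * cantor_space := (add i V, lower_cut e i V).
apply: (@analytic_symmetric_bigcup R cantor_space cantor_space f (polish_cantor R)).
move=> i V.
apply: (@cvg_pair cantor_space cantor_space cantor_space (nbhs V)
  (nbhs (add i V)) (nbhs (lower_cut e i V : cantor_space))); last exact: continuous_cut.
apply: continuous_cantor => j.
exists [set W : cantor_space | W j = V j]; first exact: cantor_coordinate_nbhs.
by move=> W /= Wj; rewrite /add Wj.
Qed.

Lemma dense_seq (R : realType) : exists e : nat -> R,
  forall a b : R, a < b -> exists i, a < e i < b.
Proof.
(* All rationals, numbered by [pickle]; [0] fills the numbers that code none. *)
exists (fun n => ratr (odflt 0 (unpickle n))) => a b ab.
have [q] := rat_in_itvoo ab; rewrite in_itv/= => qab.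
by exists (pickle q); rewrite pickleK.
Qed.

Lemma triangle_free_coloring (R : realType) (e : nat -> R) (X : topologicalType)
    (A : set (X * X)) :
  polish R X -> analytic_graph R A ->
  (forall x y z, A (x, y) -> A (y, z) -> A (x, z) -> False) ->
  has_injective_continuous_hom A (cut_graph e : set (cantor_space * cantor_space)) ->
  has_countable_borel_coloring A.
Proof.
move=> pX [[irr sym] [Y [pY [f cf fA]]]] tri [u [cu iu hu]].
pose g y := (f y).1.
have cg : continuous g by move=> y; apply: continuous_comp (@cf y) _; exact: cvg_fst.
have cg' : continuous (fun y => (f y).2).
  by move=> y; apply: continuous_comp (@cf y) _; exact: cvg_snd.
(* [D i] is the image under [g] of [P i], which is closed as [reflection] asks. *)
pose P i := [set y | u (f y).1 i /\ u (f y).2 = lower_cut e i (u (f y).1)].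
pose D i := [set x | exists y, [/\ A (x, y), u x i & u y = lower_cut e i (u x)]].
have PD i y : P i y -> D i (g y).
  move=> [uy1 uy2]; exists (f y).2; split=> //.
  by rewrite /g -surjective_pairing -fA; exists y.
have DP i x : D i x -> exists2 y, P i y & g y = x.
  by move=> [z [+ ux uz]]; rewrite -fA => -[y _ fy]; exists y; rewrite /P/= /g fy.
have clP i : closed (P i).
  have coord (h : Y -> X) y j : continuous h -> nbhs y [set z | u (h z) j = u (h y) j].
    move=> ch; have := cantor_coordinate_nbhs (u (h y)) j.
    exact: (continuous_comp (@ch y) (@cu (h y))).
  (* Either [i] is missing or the second end differs from the cut at some [j]; both persist nearby,
     as coordinates are locally constant. *)
  rewrite -[P i]setCK; apply: open_closedC; rewrite openE => y nPy.
  have [uy1|uy1] := pselect (u (f y).1 i); last first.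
    apply: filterS (coord _ y i cg) => z /= zy [uz _]; apply: uy1.
    by rewrite -zy.
  have [j uj] : exists j, u (f y).2 j <> lower_cut e i (u (f y).1) j.
    apply: contrapT => /forallNP h; apply: nPy; split=> //.
    by apply/funext => j; apply: contrapT; exact: h.
  apply: filterS2 (coord _ y j cg) (coord _ y j cg') => z /= z1 z2 [_ uz].
  by apply: uj; rewrite -z2 uz /lower_cut -z1.
have Dind i x x' : D i x -> D i x' -> ~ A (x, x').
  (* As [i] lies in the cut [u b] of [u a], both have the same cut at [i]; injectivity of [u] then
     gives [a] and [b] a common neighbour. *)
  have key a b : D i a -> D i b -> A (a, b) ->
      forall k, u a k -> u b = lower_cut e k (u a) -> False.
    move=> [y [ay uai uy]] [y' [by' ubi uy']] ab k uak ub.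
    have ik : e i <= e k by move: ubi; rewrite ub /lower_cut => /andP[_ /ltW].
    have yy' : y = y' by apply: iu; rewrite uy uy' ub lower_cut_lower_cut.
    by apply: (tri a b y) => //; rewrite yy'.
  move=> Dx Dx' xx'; have [k [[uk uE]|[uk uE]]] := hu _ xx'.
    exact: (key x x' Dx Dx' xx' k).
  exact: (key x' x Dx' Dx (sym _ _ xx') k).
have /choice[B BP] i : exists B : set X, [/\ borel B, D i `<=` B &
    forall x y, B x -> B y -> ~ A (x, y)].
  (* [reflection] yields a Borel rectangle without edges around the square of [D i]; the
     intersection of its sides is independent. *)
  have [|B1 [B2 [b1 b2 gB1 gB2 fB]]] :=
    reflection pX pY cg cg cf (clP i) (clP i) (P' := P i).
    move=> y p p' /PD Dp /PD Dp' fy; apply: (Dind i _ _ Dp Dp').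
    by rewrite -fA; exists y.
  exists (B1 `&` B2); split; first exact: borelI.
    by move=> x /DP[y Py <-]; split; [apply: gB1|apply: gB2]; exists y.
  move=> x y [Bx _] [_ By]; rewrite -fA => -[z _ fz].
  by apply: (fB z) => //; rewrite fz.
apply: (borel_coloring_of_cover (B := B)).
- by move=> n; have [] := BP n.
- by move=> n x y; have [_ _] := BP n; exact.
move=> x y nx ny Axy; have [i [[ui uE]|[ui uE]]] := hu _ Axy.
  by apply: (nx i); have [_ DB _] := BP i; apply: DB; exists y.
apply: (ny i); have [_ DB _] := BP i; apply: DB; exists x.
by split=> //; exact: sym.
Qed.

Theorem theorem10 (R : realType) :
  ~ exists (X0 : topologicalType) (R0 : set (X0 * X0)),
      [/\ polish R X0,
          analytic_graph R R0 &
          forall (X : topologicalType) (A : set (X * X)),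
            polish R X -> analytic_graph R A ->
            exactly_one (has_countable_borel_coloring A)
                        (has_injective_continuous_hom R0 A)].
Proof.
move=> [X0 [R0 [pX0 aR0 basis]]].
(* For [A = R0] the identity realizes the second alternative, which excludes the first. *)
have ncol : ~ has_countable_borel_coloring R0.
  move=> col; have [_ []] := basis _ _ pX0 aR0; split=> //.
  by exists id; split=> [x U|x y|[x y]].
have [e dense_e] := dense_seq R.
have [[|[v [_ _ hv]] _]] := basis R (@power3_graph R) (polish_real R)
    (conj (@is_graph_power3_graph R) (analytic_power3_graph R)).
  by move=> /power3_graph_not_colorable.
have [[[c _ cP]|hom] _] := basis cantor_space (cut_graph e) (polish_cantor R)
    (conj (@is_graph_cut_graph R e) (analytic_cut_graph e)).
  exact: (cut_graph_not_colorable dense_e cP).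
(* [v] carries a triangle of [R0] to one of [power3_graph]. *)
apply: ncol; apply: triangle_free_coloring hom => // x y z /hv xy /hv yz /hv xz.
exact: (power3_graph_triangle_free xy yz xz).
Qed.
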